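(* For every $n, r, t \in \mathbb{N}$ the following holds. Every graph $G$ on $n$ vertices which is $t$-far from being $r$-partite contains at least $$\frac{n^{r-1}}{e^{2r} \cdot r!}\left(e(G) + t - \left(1 - \frac{1}{r}\right) \frac{n^2}{2}\right)$$ copies of $K_{r+1}$.
   Context: Graphs are finite and simple; $\mathbb{N} = \{1,2,\dots\}$. $e(G)$ is the number of edges of $G$ (while $e$ in $e^{2r}$ is the base of the natural logarithm) and $\chi$ is the chromatic number. A graph $G$ is $t$-far from being $r$-partite if $\chi(G') > r$ for every subgraph $G' \subset G$ with $e(G') > e(G) - t$. The number of copies of $K_{r+1}$ in $G$ is the number of $(r+1)$-element vertex subsets that induce a clique in $G$. *)

(* Defs.v *)
From mathcomp Require Import all_boot.

Set Implicit Arguments.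
Unset Strict Implicit.
Unset Printing Implicit Defensive.

(* Vertices range over a subset of an ambient finite type, so that a subgraph
   may drop vertices as well as edges and is again a graph over the same type. *)
Record graph (T : finType) := Graph {
  vertices : {set T};
  edges : {set {set T}};
  edgesP : forall S : {set T}, S \in edges -> (S \subset vertices) && (#|S| == 2)
}.

Definition adjacent (T : finType) (G : graph T) (x y : T) : bool :=
  [set x; y] \in edges G.

Definition num_edges (T : finType) (G : graph T) : nat := #|edges G|.

Definition subgraph (T : finType) (H G : graph T) : bool :=
  (vertices H \subset vertices G) && (edges H \subset edges G).

Definition colorable (T : finType) (G : graph T) (k : nat) : bool :=
  [exists f : {ffun {x : T | x \in vertices G} -> 'I_k},
    [forall x, forall y, adjacent G (val x) (val y) ==> (f x != f y)]].

Lemma colorable_exists (T : finType) (G : graph T) : exists k, colorable G k.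
Proof.
exists #|{: {x : T | x \in vertices G}}|.
apply/existsP; exists [ffun x => enum_rank x].
apply/forallP=> x; apply/forallP=> y; apply/implyP=> adj_xy.
rewrite !ffunE; apply/eqP=> /enum_rank_inj eq_xy.
by move: (edgesP adj_xy); rewrite eq_xy setUid cards1 andbF.
Qed.

Definition chromatic_number (T : finType) (G : graph T) : nat :=
  ex_minn (colorable_exists G).

(* The condition e(H) > e(G) - t is written without subtraction, which would
   truncate on nat. *)
Definition far_from_partite (T : finType) (t r : nat) (G : graph T) : Prop :=
  forall H : graph T, subgraph H G ->
    num_edges G < num_edges H + t -> r < chromatic_number H.

Definition is_clique (T : finType) (G : graph T) (S : {set T}) : bool :=
  (S \subset vertices G) &&
  [forall x in S, forall y in S, (x != y) ==> adjacent G x y].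

Definition num_cliques (T : finType) (k : nat) (G : graph T) : nat :=
  #|[set S : {set T} | is_clique G S && (#|S| == k)]|.

(* Main.v *)
(** Induction on r, following Füredi's proof of the stability theorem.  For a
    vertex v of degree d(v), an (r-1)-colouring of the neighbourhood N(v)
    extends to G by giving all of V \ N(v) one new colour, so G[N(v)] is
    (t - e(V \ N(v)))-far from being (r-1)-partite.  Since
      e(N(v)) - e(V \ N(v)) = e(G) - sum_(u notin N(v)) d(u),
    summing the induction hypothesis over v and applying the rearrangement
    inequality to the nonadjacent pairs bounds the number of K_(r+1) below by
    a multiple of
      sum_v d(v)^(r-2) (Y + r/(2(r-1)) (d(v) - (1-1/r) n)^2),
    where Y = e(G) + t - (1-1/r) n^2/2.  A random r-colouring shows
    t <= e(G)/r, so if Y >= 0 the average degree is at least (r-1)/(r+1) n, and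
    (1 + 2/(r-1))^(r-1) <= e^2 yields the constant. *)
Require Import Defs.
From mathcomp Require Import all_boot all_order all_algebra.
From mathcomp Require Import reals sequences exp.
From mathcomp Require Import zify ring lra.

Set Implicit Arguments.
Unset Strict Implicit.
Unset Printing Implicit Defensive.

Import GRing.Theory Num.Theory.
Import Order.TTheory.
Local Open Scope ring_scope.

(** * Power mean and rearrangement inequalities *)

Section RealSums.
Variable R : realFieldType.

Lemma subr_exp_ge0 (x y : R) k : 0 <= x -> 0 <= y ->
  0 <= (x - y) * (x ^+ k - y ^+ k).
Proof.
move=> x0 y0; rewrite subrXX mulrA -expr2.
apply: mulr_ge0; first exact: sqr_ge0.
by apply: sumr_ge0 => i _; rewrite mulr_ge0 ?exprn_ge0.
Qed.

(** Power mean inequality, by induction on [k]: since [(x i - a) * (x i ^+ k - a ^+ k)] is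
    nonnegative, each weight [x i ^+ k] of [x i - a] may be replaced by [a ^+ k]. *)
Lemma sum_exp_ge (I : finType) (A : {set I}) (x : I -> R) a k :
  (forall i, 0 <= x i) -> 0 <= a -> #|A|%:R * a <= \sum_(i in A) x i ->
  #|A|%:R * a ^+ k <= \sum_(i in A) x i ^+ k.
Proof.
move=> x0 a0 leA; elim: k => [|k IH].
  by rewrite expr0 mulr1 sumr_const.
have sum_sub b : \sum_(i in A) (x i - a) * b =
    (\sum_(i in A) x i - #|A|%:R * a) * b.
  by rewrite -mulr_suml sumrB sumr_const mulr_natl.
apply: (@le_trans _ _ (a * \sum_(i in A) x i ^+ k)).
  by rewrite exprS mulrCA ler_wpM2l.
rewrite -subr_ge0.
apply: (@le_trans _ _ (\sum_(i in A) (x i - a) * a ^+ k)).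
  by rewrite sum_sub mulr_ge0 ?subr_ge0 ?exprn_ge0.
rewrite mulr_sumr -sumrB; apply: ler_sum => i _.
have := subr_exp_ge0 k (x0 i) a0.
by rewrite exprS mulrBr subr_ge0 -mulrBl.
Qed.

(** Adding to the difference of the two sides its copy with [i] and [j] swapped gives a sum of terms
    [c i j * ((x i - x j) * (x i ^+ k - x j ^+ k))]. *)
Lemma rearrangement_sum (I : finType) (A : {set I}) (c : I -> I -> R)
    (x : I -> R) k :
  (forall i j, c i j = c j i) -> (forall i j, 0 <= c i j) ->
  (forall i, 0 <= x i) ->
  \sum_(i in A) \sum_(j in A) c i j * (x i ^+ k * x j)
    <= \sum_(i in A) \sum_(j in A) c i j * x i ^+ k.+1.
Proof.
move=> cC c0 x0; rewrite -subr_ge0 -sumrB.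
under eq_bigr do rewrite -sumrB.
set S := (X in 0 <= X).
have S2 : S + S = \sum_(i in A) \sum_(j in A)
    c i j * ((x i - x j) * (x i ^+ k - x j ^+ k)).
  rewrite {2}/S exchange_big -big_split; apply: eq_bigr => i _ /=.
  rewrite -big_split; apply: eq_bigr => j _ /=.
  by rewrite (cC j i) !exprS; ring.
have : 0 <= S + S.
  rewrite S2; do 2![apply: sumr_ge0 => ? _].
  by rewrite mulr_ge0 // subr_exp_ge0.
lra.
Qed.

End RealSums.

(** * Counting cliques through neighbourhoods *)

Section Cliques.
Variables (T : finType) (e : rel T).

(** A relation with a vertex set [A] replaces [graph], so that the induction passes to a
    neighbourhood by changing [A] alone. *)
Definition nbhd (A : {set T}) (x : T) : {set T} := [set y in A | e x y].

Definition cliques (k : nat) (A : {set T}) : {set {set T}} :=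
  [set S : {set T} | [&& S \subset A,
    [forall x in S, forall y in S, (x != y) ==> e x y] & #|S| == k]].

Lemma cliques1 A : #|cliques 1 A| = #|A|.
Proof.
rewrite -(card_imset (mem A) (@set1_inj T)); congr #|pred_of_set _|.
apply/setP=> S; rewrite inE; apply/and3P/imsetP.
  by case=> SA _ /cards1P[x eqS]; exists x => //; rewrite -sub1set -eqS.
case=> x xA ->; split; rewrite ?sub1set ?cards1 //.
apply/forall_inP=> y /set1P->; apply/forall_inP=> z /set1P->.
by rewrite eqxx.
Qed.

Hypotheses (e_sym : symmetric e) (e_irr : irreflexive e).

(** Double counting of pairs of a clique and a vertex [v] in it; removing [v] leaves a clique in the
    neighbourhood of [v]. *)
Lemma card_cliquesS k A :
  (k.+1 * #|cliques k.+1 A| = \sum_(v in A) #|cliques k (nbhd A v)|)%N.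
Proof.
have -> : (k.+1 * #|cliques k.+1 A| =
           \sum_(S in cliques k.+1 A) \sum_(v in A) (v \in S))%N.
  rewrite mulnC -sum_nat_const; apply: eq_bigr => S.
  rewrite inE => /and3P[SA _ /eqP<-].
  rewrite -sum1_card big_mkcond [RHS]big_mkcond /=; apply: eq_bigr => v _.
  by case: ifPn => [/(subsetP SA)->|] //; case: (v \in A).
rewrite exchange_big /=; apply: eq_bigr => v vA.
rewrite -big_mkcondr sum1_card /=.
have notin S : S \in cliques k (nbhd A v) -> v \notin S.
  rewrite inE => /andP[/subsetP SN _].
  by apply/negP=> /SN; rewrite inE e_irr andbF.
rewrite -[RHS](@card_in_imset _ _ (fun S => v |: S)); last first.
  by move=> S S' /notin vS /notin vS' eqS; rewrite -(setU1K vS) eqS setU1K.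
apply: eq_card => S; apply/andP/imsetP.
  rewrite inE => -[/and3P[SA /forall_inP cS /eqP cardS] vS].
  exists (S :\ v); last by rewrite setD1K.
  rewrite inE; apply/and3P; split.
  - apply/subsetP=> x /setD1P[xv xS]; rewrite inE (subsetP SA) //=.
    by have /forall_inP/(_ x xS)/implyP := cS v vS; apply; rewrite eq_sym.
  - apply/forall_inP=> x /setD1P[_ xS]; apply/forall_inP=> y /setD1P[_ yS].
    by have /forall_inP := cS x xS; apply.
  - by rewrite -eqSS -cardS (cardsD1 v S) vS add1n.
case=> S' S'K ->; have vS' := notin _ S'K; split; last exact: setU11.
move: S'K; rewrite inE => /and3P[/subsetP SN /forall_inP cS /eqP cardS].
rewrite inE cardsU1 vS' cardS eqxx andbT; apply/andP; split.
  by rewrite subUset sub1set vA; apply/subsetP=> x /SN; rewrite inE => /andP[].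
have adj x : x \in S' -> e v x by move/SN; rewrite inE => /andP[].
apply/forall_inP=> x /setU1P xS; apply/forall_inP=> y /setU1P yS.
apply/implyP; case: xS yS => [->|xS] [->|yS]; first by rewrite eqxx.
- by rewrite adj.
- by rewrite e_sym adj.
- by apply/implyP; have /forall_inP := cS x xS; apply.
Qed.

Lemma card_cliques2 A : (2 * #|cliques 2 A| = \sum_(v in A) #|nbhd A v|)%N.
Proof. by rewrite card_cliquesS; apply: eq_bigr => v _; rewrite cliques1. Qed.

End Cliques.

(** * Ordered edge counts and monochromatic edges *)

Section Arcs.
Variable T : finType.
Implicit Types (e : rel T) (A B C : {set T}).

(* Ordered pairs: each edge inside A counts twice in [arcs e A A]. *)
Definition arcs e A B : nat :=
  (\sum_(x in A) \sum_(y in B) e x y)%N.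

(** The edges whose deletion makes [f] proper: farness becomes a lower bound on
    [arcs (mono e f) A A] for all [f]. *)
Definition mono e (C : eqType) (f : T -> C) : rel T :=
  fun x y => e x y && (f x == f y).

Lemma arcsE e A B : arcs e A B = (\sum_(x in A) #|nbhd e B x|)%N.
Proof.
apply: eq_bigr => x _; rewrite -big_mkcondr -sum1_card.
by apply: eq_bigl => y; rewrite inE.
Qed.

Lemma arcs_splitl e A B C :
  arcs e A B = (arcs e (A :&: C) B + arcs e (A :\: C) B)%N.
Proof. by rewrite /arcs (big_setID C). Qed.

Lemma arcs_splitr e A B C :
  arcs e A B = (arcs e A (B :&: C) + arcs e A (B :\: C))%N.
Proof.
by rewrite /arcs -big_split; apply: eq_bigr => x _; rewrite (big_setID C).
Qed.

Lemma arcsC e A B : symmetric e -> arcs e A B = arcs e B A.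
Proof.
move=> e_sym; rewrite /arcs exchange_big; apply: eq_bigr => x _.
by apply: eq_bigr => y _; rewrite e_sym.
Qed.

Lemma setI_nbhd e A v : A :&: nbhd e A v = nbhd e A v.
Proof. by apply/setP=> x; rewrite !inE andbA andbb. Qed.

(** Block decomposition along [N] and its complement; [arcs e (A :\: N) A] is the degree sum outside
    [N]. *)
Lemma arcs_nbhd e A v : symmetric e ->
  let N := nbhd e A v in
  (arcs e A A + arcs e (A :\: N) (A :\: N) =
   arcs e N N + 2 * arcs e (A :\: N) A)%N.
Proof.
move=> e_sym N.
rewrite (arcs_splitl e A A N) (arcs_splitr e (A :&: N) A N).
rewrite (arcs_splitr e (A :\: N) A N) setI_nbhd -/N (arcsC N (A :\: N)) //.
lia.
Qed.

(** The new colour [ord0] occurs exactly outside [N], so no monochromatic edge crosses and every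
    edge outside [N] is monochromatic. *)
Lemma arcs_mono_extend e A v k (g : {ffun T -> 'I_k}) :
  let N := nbhd e A v in
  let f := [ffun x => if x \in N then lift ord0 (g x) else ord0] in
  arcs (mono e f) A A =
    (arcs (mono e g) N N + arcs e (A :\: N) (A :\: N))%N.
Proof.
move=> N f.
have fN x : x \in N -> f x = lift ord0 (g x) by rewrite ffunE => ->.
have fD x : x \in A :\: N -> f x = ord0.
  by case/setDP=> _ /negPf xN; rewrite ffunE xN.
rewrite (arcs_splitl _ A A N) !(arcs_splitr _ _ A N) setI_nbhd -/N.
have -> : arcs (mono e f) N (A :\: N) = 0%N.
  apply: big1 => x xN; apply: big1 => y yD.
  by rewrite /mono fN // fD // eq_sym (negPf (neq_lift _ _)) andbF.
have -> : arcs (mono e f) (A :\: N) N = 0%N.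
  apply: big1 => x xN; apply: big1 => y yD.
  by rewrite /mono fD // fN // (negPf (neq_lift _ _)) andbF.
rewrite addn0 add0n; congr (_ + _)%N.
  apply: eq_bigr => x xN; apply: eq_bigr => y yN.
  by rewrite /mono !fN // (inj_eq lift_inj).
apply: eq_bigr => x xD; apply: eq_bigr => y yD.
by rewrite /mono !fD // eqxx andbT.
Qed.

(* Shifting the colour of x by every c in Z/(k+1) in turn makes the colours
   of x and y agree exactly once. *)
Lemma card_mono_pair k (x y : T) : x != y ->
  (k.+1 * \sum_(f : {ffun T -> 'I_k.+1}) (f x == f y) =
   #|{ffun T -> 'I_k.+1}|)%N.
Proof.
move=> xy.
pose sh (c : 'I_k.+1) (f : {ffun T -> 'I_k.+1}) : {ffun T -> 'I_k.+1} :=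
  [ffun z => if z == x then f z + c else f z].
have shK c : cancel (sh c) (sh (- c)).
  by move=> f; apply/ffunP=> z; rewrite !ffunE; case: eqP; rewrite ?addrK.
have shE c : (\sum_(f : {ffun T -> 'I_k.+1}) (f x == f y) =
              \sum_(f : {ffun T -> 'I_k.+1}) (f x + c == f y)%R)%N.
  rewrite (reindex_inj (can_inj (shK c))); apply: eq_bigr => f _.
  by rewrite !ffunE eqxx (eq_sym y) (negPf xy).
transitivity (\sum_(c : 'I_k.+1) \sum_(f : {ffun T -> 'I_k.+1}) (f x == f y))%N.
  by rewrite sum_nat_const card_ord.
rewrite (eq_bigr _ (fun c _ => shE c)) exchange_big -sum1_card.
apply: eq_bigr => f _.
rewrite (bigD1 (f y - f x)) //= addrC subrK eqxx big1 // => c.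
by rewrite eq_sym subr_eq eq_sym (addrC c) => /negPf->.
Qed.

(** Averaging over all colourings: each edge is monochromatic in exactly one out of [k.+1] of
    them. *)
Lemma exists_arcs_mono_le e A k : irreflexive e ->
  exists f : {ffun T -> 'I_k.+1}, (k.+1 * arcs (mono e f) A A <= arcs e A A)%N.
Proof.
move=> e_irr; apply/existsP; apply: contraT.
rewrite negb_exists => /forallP far.
have sumE : (\sum_(f : {ffun T -> 'I_k.+1}) k.+1 * arcs (mono e f) A A =
             #|{ffun T -> 'I_k.+1}| * arcs e A A)%N.
  rewrite -big_distrr /= /arcs exchange_big !big_distrr /=.
  apply: eq_bigr => x _; rewrite exchange_big !big_distrr /=.
  apply: eq_bigr => y _; case exy : (e x y); last first.
    by rewrite muln0 big1 ?muln0 // => f _; rewrite /mono exy.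
  rewrite muln1 -(@card_mono_pair k x y); last first.
    by apply: contraTneq exy => ->; rewrite e_irr.
  by congr (_ * _)%N; apply: eq_bigr => f _; rewrite /mono exy.
have : (\sum_(f : {ffun T -> 'I_k.+1}) (arcs e A A).+1 <=
        \sum_(f : {ffun T -> 'I_k.+1}) k.+1 * arcs (mono e f) A A)%N.
  by apply: leq_sum => f _; rewrite ltnNge.
have N0 : (0 < #|{ffun T -> 'I_k.+1}|)%N.
  by apply/card_gt0P; exists [ffun=> ord0].
by rewrite sumE sum_nat_const leq_pmul2l // ltnn.
Qed.

End Arcs.

(** * The induction on the number of colours *)

Section Supersaturation.
Variables (R : realType) (T : finType) (e : rel T).
Hypotheses (e_sym : symmetric e) (e_irr : irreflexive e).
Implicit Type A : {set T}.

Definition clique_factor (r : nat) : R := expR (2 * r%:R) * (r`!)%:R.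

Lemma clique_factor_ge0 r : 0 <= clique_factor r.
Proof. by rewrite mulr_ge0 ?expR_ge0 ?ler0n. Qed.

Lemma clique_factorS r :
  clique_factor r.+1 = expR 2 * r.+1%:R * clique_factor r.
Proof.
rewrite /clique_factor factS natrM.
have -> : 2 * r.+1%:R = 2 + 2 * r%:R :> R.
  by rewrite -[r.+1]add1n natrD mulrDr mulr1.
by rewrite expRD; ring.
Qed.

(** Pays for the factor by which [clique_factor] grows. The ratio (k+3)/(k+1) is 1 + 2/(k+1), so its
    power k+1 is at most e^2; finally k+1 is relaxed to k+2. *)
Lemma ratio_expn_ge k :
  k.+3%:R <= expR 2 * k.+2%:R * (k.+1%:R / k.+3%:R) ^+ k :> R.
Proof.
have k1 : 0 < k.+1%:R :> R by rewrite ltr0n.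
have k3 : 0 < k.+3%:R :> R by rewrite ltr0n.
have pos : 0 < (k.+3%:R / k.+1%:R) ^+ k :> R by rewrite exprn_gt0 ?divr_gt0.
have : (k.+3%:R / k.+1%:R) ^+ k.+1 <= expR 2 :> R.
  have -> : 2 = 2 / k.+1%:R * k.+1%:R :> R by rewrite divfK ?gt_eqF.
  rewrite expRM_natr; apply: lerXn2r; rewrite ?nnegrE ?expR_ge0 ?divr_ge0 //.
  apply: le_trans (expR_ge1Dx _).
  rewrite ler_pdivrMr // mulrDl divfK ?gt_eqF // mul1r.
  by rewrite -natrD ler_nat; lia.
rewrite exprS mulrAC ler_pdivrMr // => le2.
have -> : k.+1%:R / k.+3%:R = (k.+3%:R / k.+1%:R)^-1 :> R by rewrite invf_div.
rewrite exprVn ler_pdivlMr //.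
apply: le_trans le2 _ => //.
by rewrite ler_wpM2l ?expR_ge0 // ler_nat.
Qed.

(** With m = k+2 colours, the averaged colouring gives m s <= [arcs e A A]. The second hypothesis
    then forces average degree at least (m-1)/(m+1) times [#|A|], and the power mean inequality
    applies. *)
Lemma sum_nbhd_exp_ge A (s : R) k :
  (forall f : {ffun T -> 'I_k.+2}, s <= (arcs (mono e f) A A)%:R) ->
  0 <= (arcs e A A)%:R + s - (1 - 1 / k.+2%:R) * #|A|%:R ^+ 2 ->
  #|A|%:R ^+ k.+1 * (k.+1%:R / k.+3%:R) ^+ k
    <= \sum_(v in A) #|nbhd e A v|%:R ^+ k :> R.
Proof.
move=> s_le Y0.
have k3 : 0 < k.+3%:R :> R by rewrite ltr0n.
have k2 : 0 < k.+2%:R :> R by rewrite ltr0n.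
rewrite exprS -mulrA -exprMn.
apply: sum_exp_ge => [i||]; rewrite ?mulr_ge0 ?invr_ge0 ?ler0n //.
rewrite -natr_sum -arcsE.
have [f] := exists_arcs_mono_le A k.+1 e_irr.
rewrite -(ler_nat R) natrM => mono_le.
have s2 : k.+2%:R * s <= (arcs e A A)%:R.
  by apply: le_trans mono_le; rewrite ler_pM2l.
move: Y0; rewrite -(pmulr_rge0 _ k2) => Y0.
have -> : #|A|%:R * (#|A|%:R * (k.+1%:R / k.+3%:R)) =
  (k.+1%:R * #|A|%:R ^+ 2) / k.+3%:R :> R by rewrite expr2; ring.
rewrite ler_pdivrMr //.
have <- : k.+2%:R + 1 = k.+3%:R :> R by rewrite natr1.
have <- : k.+2%:R - 1 = k.+1%:R :> R by rewrite -[k.+2%:R]natr1 addrK.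
move: (k.+2%:R) k2 Y0 s2 => m m0.
have -> : m * ((arcs e A A)%:R + s - (1 - 1 / m) * #|A|%:R ^+ 2)
  = m * (arcs e A A)%:R + m * s - (m - 1) * #|A|%:R ^+ 2 :> R.
  by field; rewrite gt_eqF.
lra.
Qed.

(** Rearrangement with non-adjacency as the weight [c]; [v] has [#|A| - #|nbhd e A v|]
    non-neighbours in [A], itself included. *)
Lemma sum_nonadjacent_le A k :
  \sum_(v in A) #|nbhd e A v|%:R ^+ k * (arcs e (A :\: nbhd e A v) A)%:R
    <= \sum_(v in A) #|nbhd e A v|%:R ^+ k
         * ((#|A|%:R - #|nbhd e A v|%:R) * #|nbhd e A v|%:R) :> R.
Proof.
have sumD v (F : T -> R) :
    \sum_(u in A :\: nbhd e A v) F u = \sum_(u in A) (~~ e v u)%:R * F u.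
  rewrite big_mkcond [RHS]big_mkcond /=; apply: eq_bigr => u _.
  by rewrite !inE; case: (u \in A); case: (e v u); rewrite ?mul1r ?mul0r.
have cardD v : #|A|%:R - #|nbhd e A v|%:R = \sum_(u in A) (~~ e v u)%:R :> R.
  under [RHS]eq_bigr do rewrite -[_%:R]mulr1.
  rewrite -sumD sumr_const -(cardsID (nbhd e A v) A) setI_nbhd natrD.
  by rewrite addrAC subrr add0r.
have := @rearrangement_sum R T A (fun u v => (~~ e u v)%:R)
  (fun v => #|nbhd e A v|%:R) k.
have cC u v : (~~ e u v)%:R = (~~ e v u)%:R :> R by rewrite e_sym.
move/(_ cC (fun u v => ler0n _ _) (fun u => ler0n _ _)).
congr (_ <= _); apply: eq_bigr => v _.
  rewrite arcsE natr_sum sumD mulr_sumr; apply: eq_bigr => u _.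
  by rewrite mulrCA.
by rewrite cardD mulrCA -exprSr -mulr_suml.
Qed.

(* Here r = k + 1, and s is 2t because [arcs] counts ordered pairs; s may be
   negative, as happens for neighbourhoods in the induction step. *)
Lemma clique_supersaturation A (s : R) k :
  (forall f : {ffun T -> 'I_k.+1}, s <= (arcs (mono e f) A A)%:R) ->
  #|A|%:R ^+ k * ((arcs e A A)%:R + s - (1 - 1 / k.+1%:R) * #|A|%:R ^+ 2)
    <= 2 * clique_factor k.+1 * #|cliques e k.+2 A|%:R.
Proof.
elim: k A s => [|k IH] A s s_le.
  (* One colour makes every edge monochromatic, so the left side is at most four times the number of
     edges, while 2 e^2 >= 6. *)
  rewrite expr0 mul1r divr1 subrr mul0r subr0.
  have := s_le [ffun=> ord0].
  have -> : arcs (mono e [ffun=> ord0 : 'I_1]) A A = arcs e A A.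
    apply: eq_bigr => x _; apply: eq_bigr => y _.
    by rewrite /mono !ffunE eqxx andbT.
  rewrite arcsE -(card_cliques2 e_sym e_irr) natrM /clique_factor.
  rewrite factS fact0 muln1 !mulr1.
  have := @expR_ge1Dx R 2; have : 0 <= #|cliques e 2 A|%:R :> R by [].
  nra.
set Y := _ + s - _.
have [Y_lt0|Y_ge0] := ltP Y 0.
  apply: (@le_trans _ _ 0); first by rewrite nmulr_lle0 // exprn_ge0.
  by rewrite mulr_ge0 ?ler0n // mulr_ge0 ?clique_factor_ge0 ?ler0n.
pose d v : R := #|nbhd e A v|%:R.
(* The induction hypothesis in the neighbourhood, with [s] lowered by the edges outside it;
   [arcs_nbhd] trades those for a degree sum. *)
have IHv v : d v ^+ k * ((arcs e A A)%:R + s - (1 - 1 / k.+1%:R) * d v ^+ 2)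
     - 2 * (d v ^+ k * (arcs e (A :\: nbhd e A v) A)%:R)
  <= 2 * clique_factor k.+1 * #|cliques e k.+2 (nbhd e A v)|%:R.
  set N := nbhd e A v; set D := A :\: N.
  have := IH N (s - (arcs e D D)%:R).
  have far (g : {ffun T -> 'I_k.+1}) :
      s - (arcs e D D)%:R <= (arcs (mono e g) N N)%:R.
    by rewrite lerBlDr -natrD -arcs_mono_extend.
  move/(_ far); apply: le_trans.
  rewrite /d -/N [2 * _]mulrCA -mulrBr ler_wpM2l ?exprn_ge0 //.
  have : (arcs e A A)%:R + (arcs e D D)%:R =
      (arcs e N N)%:R + 2 * (arcs e D A)%:R :> R.
    by rewrite -natrM -!natrD arcs_nbhd.
  by move: (_ * #|N|%:R ^+ 2) => q h; clearbody Y D N; lra.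
have sum_low : Y * \sum_(v in A) d v ^+ k <=
    2 * clique_factor k.+1 * (k.+3%:R * #|cliques e k.+3 A|%:R).
  rewrite -natrM (card_cliquesS e_sym e_irr) natr_sum [leRHS]mulr_sumr.
  apply: le_trans (ler_sum _ (fun v _ => IHv v)).
  rewrite sumrB -[X in _ - X]mulr_sumr.
  have := sum_nonadjacent_le A k; rewrite -/d => nonadj.
  rewrite lerBrDr.
  apply: (@le_trans _ _ (Y * \sum_(v in A) d v ^+ k +
    2 * \sum_(v in A) d v ^+ k * ((#|A|%:R - d v) * d v))).
    by rewrite lerD2l ler_pM2l.
  rewrite mulr_sumr [X in _ + X]mulr_sumr -big_split; apply: ler_sum => v _ /=.
  rewrite -subr_ge0.
  have k1 : 0 < k.+1%:R :> R by rewrite ltr0n.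
  have k2 : k.+2%:R = k.+1%:R + 1 :> R by rewrite natr1.
  set m : R := k.+1%:R in k1 k2 *.
  (* Completing the square: the edge counts and [s] cancel against [Y], leaving a quadratic in [d v]
     that vanishes at the Turán degree. *)
  have -> : d v ^+ k * ((arcs e A A)%:R + s - (1 - 1 / m) * d v ^+ 2)
      - (Y * d v ^+ k + 2 * (d v ^+ k * ((#|A|%:R - d v) * d v)))
    = d v ^+ k * ((m + 1) / m * (d v - m / (m + 1) * #|A|%:R) ^+ 2).
    rewrite /Y k2; field; lra.
  by rewrite mulr_ge0 ?exprn_ge0 // mulr_ge0 ?sqr_ge0 // divr_ge0; lra.
have deg_low := sum_nbhd_exp_ge s_le Y_ge0.
have q0 : 0 < (k.+1%:R / k.+3%:R) ^+ k :> R.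
  by rewrite exprn_gt0 // divr_gt0 ?ltr0n.
(* Scaling by this power lets [deg_low] bound the left side; on the right, [ratio_expn_ge] absorbs
   the factor [k.+3] from [sum_low]. *)
rewrite -(ler_pM2r q0).
apply: (@le_trans _ _ (Y * \sum_(v in A) d v ^+ k)).
  by rewrite mulrAC [leLHS]mulrC ler_wpM2l.
apply: le_trans sum_low _.
rewrite (clique_factorS k.+1).
have := ratio_expn_ge k.
set q := (_ / _) ^+ k.
have : 0 <= 2 * clique_factor k.+1 * #|cliques e k.+3 A|%:R.
  by rewrite mulr_ge0 ?ler0n // mulr_ge0 ?clique_factor_ge0 ?ler0n.
move=> c0 /(ler_wpM2l c0); clearbody q; congr (_ <= _); ring.
Qed.

End Supersaturation.

(** * Translation from graphs to adjacency relations *)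

Section FarGraphs.
Variables (T : finType) (G : graph T).

(* Unqualified, [adjacent] refers to a notion from [sequences]. *)
Lemma adjacent_sym : symmetric (Defs.adjacent G).
Proof. by move=> x y; rewrite /Defs.adjacent setUC. Qed.

Lemma adjacent_irr : irreflexive (Defs.adjacent G).
Proof.
by move=> x; apply/negP=> /edgesP; rewrite setUid cards1 andbF.
Qed.

Lemma num_cliquesE k :
  num_cliques k G = #|cliques (Defs.adjacent G) k (vertices G)|.
Proof. by apply: eq_card => S; rewrite !inE -andbA. Qed.

Definition mono_edges (C : eqType) (f : T -> C) : {set {set T}} :=
  [set S in edges G | [forall x in S, forall y in S, f x == f y]].

(** Lets the handshake identity [card_cliques2] count monochromatic edges. *)
Lemma cliques2_mono (C : eqType) (f : T -> C) :
  cliques (mono (Defs.adjacent G) f) 2 (vertices G) = mono_edges f.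
Proof.
apply/setP=> S; rewrite !inE; apply/and3P/andP.
  case=> _ /forall_inP mS /cards2P[x [y [xy eqS]]].
  have xS : x \in S by rewrite eqS !inE eqxx.
  have yS : y \in S by rewrite eqS !inE eqxx orbT.
  have /forall_inP/(_ y yS) := mS x xS.
  rewrite xy /= /mono /Defs.adjacent -eqS => /andP[-> /eqP fxy]; split=> //.
  have fS z : z \in S -> f z = f x by rewrite eqS => /set2P[] ->.
  by apply/forall_inP=> u uS; apply/forall_inP=> v vS; rewrite !fS.
case=> SE /forall_inP mS; have /andP[SV S2] := edgesP SE.
split=> //; case/cards2P: S2 => x [y [xy eqS]].
apply/forall_inP=> u uS; apply/forall_inP=> v vS; apply/implyP=> uv.
rewrite /mono; have /forall_inP/(_ v vS) := mS u uS; move=> ->; rewrite andbT.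
rewrite /Defs.adjacent; have -> : [set u; v] = S; last by [].
apply/eqP; rewrite eqEcard subUset !sub1set uS vS /= eqS !cards2.
by rewrite uv xy.
Qed.

Lemma card_mono_edges (C : eqType) (f : T -> C) :
  (2 * #|mono_edges f| =
   arcs (mono (Defs.adjacent G) f) (vertices G) (vertices G))%N.
Proof.
rewrite arcsE -card_cliques2 ?cliques2_mono //.
  by move=> x y; rewrite /mono adjacent_sym eq_sym.
by move=> x; rewrite /mono adjacent_irr.
Qed.

Lemma num_edgesE :
  (2 * num_edges G = arcs (Defs.adjacent G) (vertices G) (vertices G))%N.
Proof.
(* A constant colouring makes all edges monochromatic. *)
have -> : arcs (Defs.adjacent G) (vertices G) (vertices G) =
          arcs (mono (Defs.adjacent G) (fun=> tt)) (vertices G) (vertices G).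
  by do 2![apply: eq_bigr => ? _]; rewrite /mono eqxx andbT.
rewrite -card_mono_edges; congr (2 * _)%N; apply: eq_card => S.
rewrite inE andb_idr // => _.
by apply/forall_inP=> x _; apply/forall_inP.
Qed.

(** Deleting the monochromatic edges leaves a subgraph properly coloured by [f]; with fewer than [t]
    deletions it would contradict farness. *)
Lemma far_mono_edges t r (f : {ffun T -> 'I_r}) :
  far_from_partite t r G -> (t <= #|mono_edges f|)%N.
Proof.
move=> far; rewrite leqNgt; apply/negP=> mono_lt.
have HP S : S \in edges G :\: mono_edges f ->
    (S \subset vertices G) && (#|S| == 2).
  by case/setDP=> /edgesP.
have := far (Graph HP).
rewrite /subgraph subxx subsetDl => /(_ isT).
have sub : mono_edges f \subset edges G.
  by apply/subsetP=> S; rewrite inE => /andP[].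
have := cardsID (mono_edges f) (edges G).
rewrite (setIidPr sub) /num_edges /= => cardE.
rewrite -cardE [X in (X < _)%N]addnC ltn_add2l => /(_ mono_lt).
rewrite ltnNge => /negP; apply.
rewrite /chromatic_number; case: ex_minnP => m _; apply.
apply/existsP; exists [ffun x => f (val x)].
apply/forallP=> x; apply/forallP=> y; apply/implyP=> /setDP[xyE].
apply: contra; rewrite !ffunE => /eqP fxy.
rewrite inE xyE; apply/forall_inP=> u /set2P ux; apply/forall_inP=> v /set2P vx.
by case: ux vx => -> [] ->; rewrite ?fxy.
Qed.

End FarGraphs.

Theorem theorem1p2 (R : realType) (n r t : nat)
    (n_gt0 : (0 < n)%N) (r_gt0 : (0 < r)%N) (t_gt0 : (0 < t)%N)
    (T : finType) (G : graph T)
    (G_order : #|vertices G| = n)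
    (G_far : far_from_partite t r G) :
  n%:R ^+ (r - 1) / (expR (2 * r%:R) * (r`!)%:R)
    * ((num_edges G)%:R + t%:R - (1 - 1 / r%:R) * (n%:R ^+ 2 / 2))
  <= (num_cliques r.+1 G)%:R :> R.
Proof.
case: r r_gt0 G_far => // k _ far.
have s_le (f : {ffun T -> 'I_k.+1}) :
    2 * t%:R <=
      (arcs (mono (Defs.adjacent G) f) (vertices G) (vertices G))%:R :> R.
  by rewrite -card_mono_edges -natrM ler_nat leq_mul2l far_mono_edges.
(* Ordered pairs double both e(G) and [t], so this is twice the goal, with the denominator
   cleared. *)
have := clique_supersaturation (@adjacent_sym T G) (@adjacent_irr T G) s_le.
rewrite G_order -num_edgesE -num_cliquesE natrM.
rewrite -/(clique_factor R k.+1) subn1 /=.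
set C := clique_factor R k.+1 => main.
have C0 : 0 < C by rewrite mulr_gt0 ?expR_gt0 // ltr0n fact_gt0.
rewrite mulrAC ler_pdivrMr // -(ler_pM2l (ltr0n R 2 : 0 < 2)).
move: main; congr (_ <= _); last by ring.
by field; rewrite nat1r pnatr_eq0.
Qed.
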